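(* Let $\theta\in(0,1)$ be irrational with continued fraction expansion $\theta=\cfrac{1}{c_0+\cfrac{1}{c_1+\cdots}}$, where all $c_i\ge2$ are integers, and let $D_\infty=\langle a,b\rangle$ act on the path space $\Omega(\mathsf B)$ of the Bratteli diagram $\mathsf B$ associated with $\theta$. Then the dihedral group $D_\infty$ defined by its action on $\Omega(\mathsf B)$ is of bounded type if and only if the sequence $(c_0,c_1,\dots)$ is bounded.
   Context: **The diagram and action.** Put $\theta_0=\theta$, $\theta_{n-1}=1/(c_{n-1}+\theta_n)$, $c_{n-1}=\lfloor1/\theta_{n-1}\rfloor$. The diagram $\mathsf B$ has $V_n=\{0,1\}$ for $n\ge0$ and edge sets $E_n$ from $V_{n-1}$ to $V_n$, $n\ge1$, consisting of edges $I_0^{(n)},\dots,I_{c_{n-1}}^{(n)}$ with range $0$ and $J_0^{(n)},\dots,J_{c_{n-1}-1}^{(n)}$ with range $1$; $I_0^{(n)},J_0^{(n)}$ have source $0$, all others have source $1$. Paths are written right to left, $\dots e_2e_1$, with the range of $e_i$ equal to the source of $e_{i+1}$; $\Omega(\mathsf B)$ is the space of infinite paths starting in $V_0$. Let $\Omega^{(i)}$ be the space of infinite paths $\dots e_{i+1}e_i$ starting in $V_{i-1}$. Involutions $a^{(i)},b^{(i)}$ of $\Omega^{(i)}$ are defined recursively (right actions). In each of the two lists $I_0^{(i)},I_1^{(i)},\dots,I_{c_{i-1}}^{(i)}$ and $J_0^{(i)},\dots,J_{c_{i-1}-1}^{(i)}$, consecutive elements are joined alternately by $a,b,a,b,\dots$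 (the first pair by $a$). Let $p=\dots e_{i+1}e_i$ and let $x$ be $a$ or $b$. (i) If $x$ joins $e_i$ to $e_i'$, then $p\cdot x^{(i)}=\dots e_{i+1}e_i'$. (ii) If $e_i\in\{I_0^{(i)},J_0^{(i)}\}$, then $p\cdot b^{(i)}=q\,e'$, where $q=(\dots e_{i+2}e_{i+1})\cdot a^{(i+1)}$ and $e'\in\{I_0^{(i)},J_0^{(i)}\}$ is the edge whose range is the source of the first edge of $q$. (iii) If $e_i$ is the last element of its list and $x$ is the generator that does not join it to its predecessor, then $p\cdot x^{(i)}=\big((\dots e_{i+2}e_{i+1})\cdot b^{(i+1)}\big)e_i$. Then $a=a^{(1)}$, $b=b^{(1)}$ generate the infinite dihedral group $D_\infty$ acting on $\Omega(\mathsf B)$ (this action is conjugate to the lift, to the Cantor set obtained from $\mathbb R/\mathbb Z$ by doubling the points of the orbit of $0$, of the reflections $x\mapsto1-x$, $x\mapsto\theta-x$). **Tiles.** For $j\in V_n$, the $n$-th level tile $\mathcal T_{j,n}$ has as vertices the paths of length $n$ starting in $V_0$ and ending in $j$; $\gamma_1,\gamma_2$ are joined by an edge labeled $x\in\{a,b\}$ if $(w\gamma_1)\cdot x=w\gamma_2$ for every infinite continuation $w$. If no edge labeled $x$ issues from $\gamma_1$, then $\gamma_1$ is a boundary point of $\mathcal T_{j,n}$ (with boundary edge $x$). The infinite tile of $\dots e_2e_1$ is the inductive limit of the finite tiles along the embeddings $\eta\mapsto e_i\eta$; a vertex of an infinite tile is a boundary point if all its truncations $e_n\dots e_1$ are boundary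 points of finite tiles. **Bounded type.** $D_\infty$ with this action is of bounded type if (1) the numbers of boundary points of finite tiles are uniformly bounded and there are only finitely many boundary points of infinite tiles; (2) $|V_n|$ and $|E_n|$ are uniformly bounded over $n$. *)

(* Defs.v *)
From mathcomp Require Import all_boot all_order all_algebra.
From mathcomp Require Import boolp classical_sets functions cardinality reals.

Set Implicit Arguments.
Unset Strict Implicit.
Unset Printing Implicit Defensive.

Local Open Scope classical_set_scope.
Local Open Scope card_scope.

Fixpoint cf_rem (R : realType) (theta : R) (n : nat) : R :=
  if n is m.+1 then
    ((cf_rem theta m)^-1 - (Num.floor (cf_rem theta m)^-1)%:~R)%R
  else theta.

Definition cf_coef (R : realType) (theta : R) (n : nat) : nat :=
  `|Num.floor (cf_rem theta n)^-1|%N.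

(* Vertices are booleans, false for 0 and true for 1.  The pair (j, k) is the
   edge with range j and position k in its list: I_k is (false, k) and J_k is
   (true, k).  Only I_0 and J_0 have source 0. *)
Definition edge : Type := (bool * nat)%type.
Definition range_of (e : edge) : bool := e.1.
Definition source_of (e : edge) : bool := e.2 != 0.

Definition list_len (m : nat) (j : bool) : nat := if j then m else m.+1.

Definition V (n : nat) : set bool := [set: bool].

(* E c n is the set of edges from V_n to V_(n+1), determined by c_n. *)
Definition E (c : nat -> nat) (n : nat) : set edge :=
  [set e | e.2 < list_len (c n) (range_of e)].

(* A path lists its edges in the order in which they are followed: the path
   written ... e_2 e_1 is the sequence e_1, e_2, ... *)
Definition ipath : Type := nat -> edge.
Definition pcons (e : edge) (p : ipath) : ipath :=
  fun n => if n is m.+1 then p m else e.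
Definition ptail (p : ipath) : ipath := fun n => p n.+1.

(* Infinite paths starting in V_i. *)
Definition Omega (c : nat -> nat) (i : nat) : set ipath :=
  [set p | forall n, E c (i + n) (p n) /\ range_of (p n) = source_of (p n.+1)].

Inductive gen := ga | gb.

(* [joins x k] says that x joins the elements k and k+1 of a list. *)
Definition joins (x : gen) (k : nat) : bool :=
  match x with ga => ~~ odd k | gb => odd k end.

(* The position joined to k by x in a list of length l. *)
Definition joined (x : gen) (l k : nat) : option nat :=
  if (k.+1 < l) && joins x k then Some k.+1
  else if (0 < k) && joins x k.-1 then Some k.-1
  else None.

(* The first edge of p . a depends only on the first edge of p, because the
   generator a joins positions 0 and 1 of both lists. *)
Definition a_first (m : nat) (e : edge) : edge :=
  if joined ga (list_len m (range_of e)) e.2 is Some k then (range_of e, k)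
  else e.

(* [act c x i p n] is the n-th edge of p . x for p in [Omega c i].  The three
   defining rules of the action are the lemmas act_joined, act_first and
   act_last below. *)
Fixpoint act (c : nat -> nat) (x : gen) (i : nat) (p : ipath) (n : nat) : edge :=
  let e := p 0 in
  match joined x (list_len (c i) (range_of e)) e.2 with
  | Some k => pcons (range_of e, k) (ptail p) n
  | None =>
      if e.2 == 0 then
        if n is m.+1 then act c ga i.+1 (ptail p) m
        else (source_of (a_first (c i.+1) (p 1)), 0)
      else
        if n is m.+1 then act c gb i.+1 (ptail p) m else e
  end.

Section ActionRules.
Variable c : nat -> nat.
Hypothesis c_ge2 : forall n, 2 <= c n.

Lemma list_len_gt1 n j : 1 < list_len (c n) j.
Proof. by case: j => //=; rewrite ltnS ltnW. Qed.

Lemma act_joined x i p k :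
  joined x (list_len (c i) (range_of (p 0))) (p 0).2 = Some k ->
  act c x i p = pcons (range_of (p 0), k) (ptail p).
Proof. by move=> h; apply/funext => -[|n] /=; rewrite h. Qed.

Lemma act_ga_first i p : act c ga i p 0 = a_first (c i) (p 0).
Proof.
rewrite /= /a_first; case ej: (joined _ _ _) => [k|] //=.
by case: ((p 0).2 =P 0) => // p0; move: ej; rewrite p0 /joined list_len_gt1.
Qed.

Lemma act_first i p :
  (p 0).2 = 0 ->
  let q := act c ga i.+1 (ptail p) in
  act c gb i p = pcons (source_of (q 0), 0) q.
Proof.
move=> p0; have ej l : joined gb l (p 0).2 = None by rewrite p0 /joined andbF.
apply/funext => -[|n]; last by rewrite /= ej p0.
by rewrite [RHS]/pcons act_ga_first /= ej p0.
Qed.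

Lemma act_last x i p :
  (p 0).2.+1 = list_len (c i) (range_of (p 0)) -> ~~ joins x (p 0).2.-1 ->
  act c x i p = pcons (p 0) (act c gb i.+1 (ptail p)).
Proof.
move=> last_p xNj; have p0 : (p 0).2 != 0.
  apply/eqP => p0; have := list_len_gt1 i (range_of (p 0)).
  by rewrite -last_p p0.
have ej : joined x (list_len (c i) (range_of (p 0))) (p 0).2 = None.
  by rewrite /joined -last_p ltnn /= (negPf xNj) andbF.
by apply/funext => -[|n] /=; rewrite ej (negPf p0).
Qed.

Lemma act_cases x i p : E c i (p 0) ->
  [\/ exists k, joined x (list_len (c i) (range_of (p 0))) (p 0).2 = Some k,
      x = gb /\ (p 0).2 = 0 |
      (p 0).2.+1 = list_len (c i) (range_of (p 0)) /\ ~~ joins x (p 0).2.-1].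
Proof.
rewrite /E /= => ltk; case ej: (joined _ _ _) => [k|]; first by constructor 1; exists k.
have := list_len_gt1 i (range_of (p 0)); move: ltk ej; rewrite /joined.
move: (list_len _ _) (p 0).2 => l [|k] ltk.
  by case: x => [+ l1|_ _]; [rewrite l1 | constructor 2].
case: ifP => // N1; case: ifP => // N2 _ _; constructor 3; split; last exact/negbT.
apply/eqP; rewrite eqn_leq ltk leqNgt; apply: contraFN N1 => ->.
by case: x N2 => /=; [move=> -> | move=> /negbT].
Qed.

Lemma joined_lt x l k k' : k < l -> joined x l k = Some k' -> k' < l.
Proof.
rewrite /joined; case: ifP => [/andP[? _] _ [<-]//|_] ltk.
by case: ifP => // _ [<-]; apply: leq_ltn_trans (leq_pred _) ltk.
Qed.

Lemma joinedK x l k k' : k < l -> joined x l k = Some k' -> joined x l k' = Some k.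
Proof.
rewrite /joined => ltk; case: ifP => [/andP[lk jk] [<-]|_].
  by rewrite /= jk; case: x jk => /= -> /=; rewrite ?andbF.
case: ifP => // /andP[k0 jk] [<-]; case: k k0 ltk jk => //= k _ -> jk.
by rewrite jk.
Qed.

Lemma act_gb_source i p :
  E c i (p 0) -> source_of (act c gb i p 0) = source_of (p 0).
Proof.
move=> Ep; have [[k ej]|[_ p0]|[pl jN]] := act_cases gb Ep.
- rewrite (act_joined ej) /source_of /=; move: ej; rewrite /joined.
  case: ifP => [/andP[_ /=]|_]; first by case: (p 0).2 => // ? _ [<-].
  by case: ifP => // /andP[_]; case: (p 0).2 => [|[|?]] //= _ [<-].
- by rewrite act_first // /source_of /= p0.
- by rewrite act_last.
Qed.

Lemma Omega_ptail i p : Omega c i p -> Omega c i.+1 (ptail p).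
Proof. by move=> Op n; have := Op n.+1; rewrite addnS addSn. Qed.

Lemma act_Omega x i p : Omega c i p -> Omega c i (act c x i p).
Proof.
move=> Op n; elim: n x i p Op => [|n IH] x i p Op.
  have [+ rs] := Op 0; rewrite addn0 => Ep.
  have [[k ej]|[-> p0]|[pl jN]] := act_cases x Ep.
  - by rewrite (act_joined ej) /E /=; split=> //; apply: joined_lt ej.
  - by rewrite act_first // /E /=; split=> //; rewrite ltnW// list_len_gt1.
  - rewrite act_last //; split => //=; rewrite act_gb_source //.
    by have [] := Op 1; rewrite addn1.
have [+ _] := Op 0; rewrite addn0 => Ep; have IHp y := IH y _ _ (Omega_ptail Op).
rewrite addnS -addSn; have [[k ej]|[-> p0]|[pl jN]] := act_cases x Ep.
- by rewrite (act_joined ej); apply: Omega_ptail Op n.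
- by rewrite act_first //; apply: IHp.
- by rewrite act_last //; apply: IHp.
Qed.

Lemma actK x i p : Omega c i p -> act c x i (act c x i p) = p.
Proof.
move=> Op; apply/funext => n; elim: n x i p Op => [|n IH] x i p Op.
  have [+ rs] := Op 0; rewrite addn0 => Ep.
  have [[k ej]|[-> p0]|[pl jN]] := act_cases x Ep.
  - rewrite (act_joined ej) (@act_joined _ _ _ (p 0).2) /=; last exact: joinedK ej.
    by case: (p 0).
  - rewrite act_first // act_first //.
    change ((source_of (act c ga i.+1 (act c ga i.+1 (ptail p)) 0), 0) = p 0).
    have -> : act c ga i.+1 (act c ga i.+1 (ptail p)) 0 = p 1.
      rewrite !act_ga_first -[ptail p 0]/(p 1).
      rewrite /a_first.
      case ej: (joined _ (list_len _ (range_of (p 1))) (p 1).2) => [k|] /=.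
        2: by rewrite ej.
      rewrite (joinedK _ ej); first by case: (p 1).
      by have [] := Op 1; rewrite addn1.
    by case: (p 0) rs p0 => j k /= <- ->.
  - by rewrite act_last // act_last.
have [+ _] := Op 0; rewrite addn0 => Ep; have IHp y := IH y _ _ (Omega_ptail Op).
have [[k ej]|[-> p0]|[pl jN]] := act_cases x Ep.
- rewrite (act_joined ej) (@act_joined _ _ _ (p 0).2) //=; exact: joinedK ej.
- by rewrite act_first // act_first //=; apply: IHp.
- by rewrite act_last // act_last //; apply: IHp.
Qed.

End ActionRules.

(* Vertices of the level n tile of j; a finite path starts with e_1. *)
Fixpoint tile (c : nat -> nat) (j : bool) (n : nat) : set (seq edge) :=
  if n is m.+1 then
    [set g | exists e g', [/\ E c m e, range_of e = j,
                              tile c (source_of e) m g' & g = rcons g' e]]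
  else [set [::]].

(* The infinite path written w g: the finite path g followed by w. *)
Definition pcat (g : seq edge) (w : ipath) : ipath :=
  fun n => nth (w (n - size g)) g n.

Definition tile_edge (c : nat -> nat) (j : bool) (n : nat) (x : gen)
    (g1 g2 : seq edge) : Prop :=
  [/\ tile c j n g1, tile c j n g2 &
      forall w, Omega c n w -> source_of (w 0) = j ->
        act c x 0 (pcat g1 w) = pcat g2 w].

Definition tile_boundary (c : nat -> nat) (j : bool) (n : nat) :
    set (seq edge) :=
  [set g | tile c j n g /\ exists x, ~ exists g', tile_edge c j n x g g'].

(* The image of g in the inductive limit of the finite tiles along the
   embeddings g |-> e_i g is the infinite path that continues g along p. *)
Definition inf_tile (c : nat -> nat) (p : ipath) : set ipath :=
  [set q | exists n g, tile c (source_of (p n)) n g /\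
                       q = pcat g (fun k => p (n + k))].

Definition inf_tile_boundary (c : nat -> nat) (p : ipath) : set ipath :=
  [set q | inf_tile c p q /\
           forall n, tile_boundary c (source_of (q n)) n (mkseq q n)].

(* Bounded type of the group generated by [act c ga 0] and [act c gb 0] acting
   on [Omega c 0]. *)
Definition bounded_type (c : nat -> nat) : Prop :=
  [/\ exists N, forall j n, tile_boundary c j n #<= `I_N,
      finite_set (\bigcup_(p in Omega c 0) inf_tile_boundary c p) &
      exists N, forall n, V n #<= `I_N /\ E c n #<= `I_N].

(* Main.v *)
Require Import Defs.
From mathcomp Require Import all_boot all_order all_algebra.
From mathcomp Require Import boolp classical_sets functions cardinality reals.
From mathcomp Require Import zify.

(** A generator crosses the first n edges of a path only if it stays unjoined
    at each of them, and at level n it then acts as a or as b.  Read backwards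
    this is deterministic: if the n-th edge ends in j and the action beyond it
    is by a, the edge is number 0 of the list of j and the preceding generator
    was b; if it is by b, the edge is the last one of that list,
    and the parity of the length of the list tells the preceding generator.
    So a tile has at most two boundary points, whatever the c_i are, and
    an infinite boundary point has at most four possible truncations at each
    level.  Hence only the bound on the number of edges constrains the c_i. *)

Local Open Scope classical_set_scope.
Local Open Scope card_scope.

Lemma subset_seq_card_le {T : eqType} (x0 : T) {A : set T} {s : seq T} {N : nat} :
  A `<=` [set` s] -> size s <= N -> A #<= `I_N.
Proof.
move=> As sN; apply: (@card_le_trans _ _ _ (nth x0 s @` `I_N)).
  apply: subset_card_le => x /As /= xs; exists (index x s); last exact: nth_index.
  by rewrite /= (leq_trans _ sN) // index_mem.
exact: card_image_le.
Qed.

(** Any two distinct sequences differ at some index; [n] is chosen beyond one such index for every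
    pair below [k]. *)
Lemma mkseq_separates {T : eqType} (f : nat -> nat -> T) (k : nat) :
  injective f -> exists n, {in gtn k &, injective (fun i => mkseq (f i) n)}.
Proof.
move=> f_inj.
have /choice[d dP] (ij : nat * nat) :
    exists m, f ij.1 m = f ij.2 m -> ij.1 = ij.2.
  apply/not_existsP => /= ne; suff: ij.1 = ij.2 by move/(fun h _ => h)/(ne 0).
  apply: f_inj; apply/funext => m; apply: contrapT => neq.
  by apply: (ne m) => /neq.
exists (\max_(i < k) \max_(j < k) (d (nat_of_ord i, nat_of_ord j)).+1).
move=> i j ik jk; set n := bigop.body _ _ _ => eqij; apply: (dP (i, j)) => /=.
have dn : d (i, j) < n.
  apply: leq_trans (leq_bigmax (Ordinal ik)).
  exact: (leq_bigmax (F := fun j => (d (i, nat_of_ord j)).+1) (Ordinal jk)).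
have x0 := f 0 0.
by have /(congr1 (nth x0 ^~ (d (i, j)))) := eqij; rewrite !nth_mkseq.
Qed.

(** An infinite [S] would contain k+1 distinct sequences, hence k+1 distinct truncations at one
    common level, too many for [F n]. *)
Lemma finite_truncations {T : pointedType} (S : set (nat -> T)) (k : nat)
    (F : nat -> seq (seq T)) :
    (forall n, size (F n) <= k) ->
    (forall q n, S q -> mkseq q n \in F n) ->
  finite_set S.
Proof.
move=> Fk SF; apply: contrapT => /infiniteP /pcard_leP[f].
have f_inj : injective f by move=> i j; apply: (inj (f := f)); rewrite in_setT.
have [n sepn] := mkseq_separates f k.+1 f_inj.
have: uniq [seq mkseq (f i) n | i <- iota 0 k.+1].
  rewrite map_inj_in_uniq ?iota_uniq // => i j.
  by rewrite !mem_iota /= add0n; apply: sepn.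
move=> /(@uniq_leq_size _ _ (F n)); rewrite size_map size_iota => le.
suff /le/leq_trans/(_ (Fk n)) : {subset [seq mkseq (f i) n | i <- iota 0 k.+1] <= F n}.
  by rewrite ltnn.
by move=> _ /mapP[i _ ->]; apply: SF; apply: funS.
Qed.

Lemma pcat_nil w : pcat [::] w = w.
Proof. by apply/funext => n; rewrite /pcat subn0 nth_nil. Qed.

Lemma pcat_rcons g e w : pcat (rcons g e) w = pcat g (pcons e w).
Proof.
apply/funext => n; rewrite /pcat nth_rcons size_rcons.
case: ltngtP => [ng|gn|->]; last by rewrite subnn [RHS]nth_default.
  exact: (set_nth_default _ _ ng).
by rewrite [RHS]nth_default ?(ltnW gn) // -(subnSK gn).
Qed.

Lemma mkseq_pcat g w : mkseq (pcat g w) (size g) = g.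
Proof.
apply: (@eq_from_nth _ (false, 0)); rewrite size_mkseq // => i ig.
by rewrite nth_mkseq // /pcat (set_nth_default (false, 0)).
Qed.

Section BoundaryPoints.
Variable c : nat -> nat.
Hypothesis c_ge2 : forall n, 2 <= c n.

(* The only path of length n ending in j which some generator crosses so as to
   act on the continuation by s. *)
Fixpoint crossed (j : bool) (s : gen) (n : nat) : seq edge :=
  if n is m.+1 then
    match s with
    | ga => rcons (crossed false gb m) (j, 0)
    | gb => let l := list_len (c m) j in
            rcons (crossed true (if odd l then ga else gb) m) (j, l.-1)
    end
  else [::].

Lemma tile_mkseq {p} n : Omega c 0 p -> tile c (source_of (p n)) n (mkseq p n).
Proof.
move=> Op; elim: n => //= n IH; exists (p n), (mkseq p n).
have [Ep rs] := Op n; split=> //.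
by rewrite /mkseq -addn1 iotaD map_cat cats1.
Qed.

Lemma pcat_Omega {j n g w} :
  tile c j n g -> Omega c n w -> source_of (w 0) = j -> Omega c 0 (pcat g w).
Proof.
elim: n j g w => [|n IH] j g w /=; first by move=> ->; rewrite pcat_nil.
case=> e [g' [Ee rj tg ->]] Ow sw; rewrite pcat_rcons.
apply: IH tg _ _ => //; case=> [|m] /=; first by rewrite addn0 rj sw.
by have := Ow m; rewrite addnS addSn.
Qed.

Lemma tile_continuation j n : exists2 w, Omega c n w & source_of (w 0) = j.
Proof.
(* The first edge is I_0 or I_1, of source [j] and range 0; repeating I_0 continues it. *)
exists (pcons (false, nat_of_bool j) (fun=> (false, 0))) => [|]; last by case: j.
by case=> [|m]; split=> //; have := c_ge2 (n + 0); rewrite /E /=; case: (j) => /=; lia.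
Qed.

(* In the second case h takes the first edge of w because rule (ii) of the
   action sets the last edge of the prefix according to it. *)
Lemma act_pcat x {j n g} : tile c j n g ->
  (exists g', size g' = n /\ forall w, act c x 0 (pcat g w) = pcat g' w) \/
  (exists s h, [/\ g = crossed j s n, forall e, size (h e) = n &
     forall w, act c x 0 (pcat g w) = pcat (h (w 0)) (act c s n w)]).
Proof.
elim: n j g => [|n IH] j g /=.
  move=> ->; right; exists x, (fun=> [::]); split=> // w.
  by rewrite !pcat_nil.
case=> e [g' [Ee rj tg ->]]; have [[g'' [sg actg]]|] := IH _ _ tg.
  by left; exists (rcons g'' e); rewrite size_rcons sg; split=> // w; rewrite !pcat_rcons.
case=> s [h [def_g sh actg]].
(* [act_cases] looks only at the first edge, so the constant path at [e] stands in for [pcons e w]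
   with any [w]. *)
have [[k ej]|[sb e0]|[el jN]] := @act_cases c c_ge2 s n (fun=> e) Ee.
- left; exists (rcons (h e) (range_of e, k)); rewrite size_rcons sh; split=> // w.
  by rewrite !pcat_rcons actg (@act_joined c s n (pcons e w) k ej).
- right; exists ga, (fun e' => rcons (h e) (source_of (a_first (c n.+1) e'), 0)).
  split=> [|e'|w]; last 1 first.
  + rewrite !pcat_rcons actg sb (@act_first c c_ge2 n (pcons e w)) //.
    by rewrite (act_ga_first c_ge2).
  + by rewrite def_g sb; case: (e) e0 rj => i k /= -> ->.
  + by rewrite size_rcons sh.
- right; exists gb, (fun=> rcons (h e) e).
  split=> [|e'|w]; last 1 first.
  + by rewrite !pcat_rcons actg (@act_last c c_ge2 s n (pcons e w)).
  (* In a list of length l, the generator that does not join the last two elements is a exactly when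
     l is odd. *)
  + move: (list_len_gt1 c_ge2 n j) el jN def_g.
    case: e rj {Ee tg sh actg} => _ k /= ->; rewrite /source_of /= => + el; rewrite -el.
    case: k {el} => [//|k] _; rewrite /= negbK.
    by case: s => /= [/negPn|/negbTE] -> ->.
  + by rewrite size_rcons sh.
Qed.

Lemma tile_boundary_sub {j n} :
  tile_boundary c j n `<=` [set` [:: crossed j ga n; crossed j gb n]].
Proof.
move=> g [tg [x no_edge]] /=; have [[g' [sg' actg]]|] := act_pcat x tg; last first.
  by case=> -[] [h [-> _ _]]; rewrite !inE eqxx ?orbT.
case: no_edge; exists g'; split=> //.
(* That [g'] lies in the tile is read off one continuation: it is the truncation of the image of
   [pcat g w], a path of [Omega c 0]. *)
have [w Ow sw] := tile_continuation j n.
have /(tile_mkseq n) := act_Omega c_ge2 x (pcat_Omega tg Ow sw).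
by rewrite actg -{3}sg' mkseq_pcat /pcat sg' subnn nth_default ?sg' // sw.
Qed.

Lemma inf_tile_boundary_finite :
  finite_set (\bigcup_(p in Omega c 0) inf_tile_boundary c p).
Proof.
pose F n := [seq crossed j s n | j <- [:: false; true], s <- [:: ga; gb]].
apply: (@finite_truncations _ _ 4 F) => // q n [p _ [_ /(_ n)]].
by move=> /tile_boundary_sub /=; rewrite !inE; case: source_of => /orP[] ->; rewrite ?orbT.
Qed.

Lemma bounded_typeP : bounded_type c <-> exists M, forall i, c i <= M.
Proof.
split=> [[_ _ [N VE]]|[M cM]].
  exists N => i; have [_] := VE i.
  apply: contraPT; rewrite -ltnNge => Nc EN.
  (* If c_i > N, then I_0, ..., I_N are already N+1 edges. *)
  have : `I_N.+1 #<= `I_N.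
    apply: card_le_trans EN; apply: card_le_trans (card_image_le snd _).
    by apply: subset_card_le => k /= kN; exists (false, k) => //; rewrite /E /=; lia.
  by rewrite card_le_II ltnn.
split; last 1 first.
(* Two lists, each of at most M+1 edges. *)
- exists (2 * M.+1)%N => n; split.
    by apply: (subset_seq_card_le false (s := [:: false; true])) => [[]|] //=; lia.
  pose s := allpairs pair [:: false; true] (iota 0 M.+1).
  apply: (subset_seq_card_le (false, 0) (s := s)) => [[j k] klt|].
    apply: allpairs_f; first by case: j {klt}.
    by rewrite mem_iota; have := cM n; case: j klt; rewrite /E /=; lia.
  by rewrite size_allpairs size_iota.
- by exists 2 => j n; apply: (subset_seq_card_le [::] tile_boundary_sub).
- exact: inf_tile_boundary_finite.
Qed.

End BoundaryPoints.

Local Open Scope ring_scope.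

Theorem corollary5p6 (R : realType) (theta : R)
    (theta01 : 0 < theta < 1) (theta_irr : irrational theta)
    (c_ge2 : forall i : nat, (2 <= cf_coef theta i)%N) :
  bounded_type (cf_coef theta) <->
  exists M : nat, forall i : nat, (cf_coef theta i <= M)%N.
Proof. exact: bounded_typeP. Qed.
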